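(* Let $S\in\mathbb{S}_+^d$, let $x_1,\dots,x_n\in\mathbb{R}^d$, and let $y_i=x_i^\top Sx_i$ for $i=1,\dots,n$. Suppose $C_n=\frac1n\sum_{i=1}^n x_ix_i^\top$ is positive definite. Then $$\operatorname*{argmin}_{\Sigma\in\mathbb{S}_+^d}\ \frac1{2n}\Bigl\|\sqrt{\mathcal{A}(C_n^{-1/2}\Sigma C_n^{-1/2})}-\sqrt{y}\Bigr\|_2^2\;=\;\operatorname*{argmin}_{\Sigma\in\mathbb{S}_+^d}\ \frac1{2n}\sum_{i=1}^n d_{\mathrm{BW}}^2\bigl(\Sigma,\;y_iC_n^{-1/2}x_ix_i^\top C_n^{-1/2}\bigr),$$ and $C_n^{1/2}SC_n^{1/2}$ is a solution to both problems. Here $\mathcal{A}(\Sigma)=(x_1^\top\Sigma x_1,\dots,x_n^\top\Sigma x_n)^\top$, $y=(y_1,\dots,y_n)^\top$, and square roots of vectors are taken componentwise.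
   Context: $\mathbb{S}_+^d$ is the set of $d\times d$ real positive semidefinite matrices. The Bures-Wasserstein distance on $\mathbb{S}_+^d$ is $d_{\mathrm{BW}}^2(\Sigma_0,\Sigma_1)=\mathrm{Tr}[\Sigma_0+\Sigma_1-2(\Sigma_0^{1/2}\Sigma_1\Sigma_0^{1/2})^{1/2}]$. ''argmin'' denotes the set of all minimizers. *)

(* Defs.v *)
From HB Require Import structures.
From mathcomp Require Import all_boot all_order all_algebra.
From mathcomp Require Import boolp classical_sets reals.

Set Implicit Arguments.
Unset Strict Implicit.
Unset Printing Implicit Defensive.

Import Order.TTheory GRing.Theory Num.Theory.

Local Open Scope classical_set_scope.
Local Open Scope ring_scope.

Section Definitions.
Variable R : realType.

Definition qform (d : nat) (A : 'M[R]_d) (v : 'cV[R]_d) : R :=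
  (v^T *m A *m v) 0 0.

Definition psdmx (d : nat) : set 'M[R]_d :=
  [set A | A^T = A /\ forall v, 0 <= qform A v].

Definition pdmx (d : nat) : set 'M[R]_d :=
  [set A | A^T = A /\ forall v, v != 0 -> 0 < qform A v].

(* A positive semidefinite matrix has exactly one positive semidefinite square
   root, so for such A the choice made by [xget] is forced; the default 0 is
   only reached when A is not positive semidefinite. *)
Definition sqrtmx (d : nat) (A : 'M[R]_d) : 'M[R]_d :=
  xget 0 [set B | psdmx B /\ B *m B = A].

Definition invsqrtmx (d : nat) (A : 'M[R]_d) : 'M[R]_d := invmx (sqrtmx A).

(* The squared distance, not the distance itself. *)
Definition bw_dist2 (d : nat) (A0 A1 : 'M[R]_d) : R :=
  \tr (A0 + A1 - 2 *: sqrtmx (sqrtmx A0 *m A1 *m sqrtmx A0)).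

(* The Euclidean norm is spelled out because the library's norm on matrices is
   the maximum norm. *)
Definition sqnorm2 (n : nat) (v : 'cV[R]_n) : R := \sum_(i < n) v i 0 ^+ 2.

Definition argmin (T : Type) (D : set T) (f : T -> R) : set T :=
  [set t | D t /\ forall u, D u -> f t <= f u].

Variables (d n : nat) (x : 'I_n -> 'cV[R]_d).

Definition quad_meas (A : 'M[R]_d) : 'cV[R]_n := \col_i qform A (x i).

Definition emp_cov : 'M[R]_d := n%:R^-1 *: \sum_(i < n) x i *m (x i)^T.

End Definitions.

(* Main.v *)
(** Put [z_i = C^(-1/2) x_i], so that [sum_i z_i z_i^T = n I] and hence
    [sum_i z_i^T Sigma z_i = n tr Sigma]. For a rank-one second argument the
    Bures-Wasserstein distance is explicit,
      [d_BW^2(Sigma, y_i z_i z_i^T)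
         = tr Sigma + y_i |z_i|^2 - 2 sqrt(y_i) sqrt(z_i^T Sigma z_i)],
    so the two objectives differ by a constant. The first one is nonnegative
    and vanishes at [C^(1/2) S C^(1/2)]. *)
Require Import Defs.
From HB Require Import structures.
From mathcomp Require Import all_boot all_order all_algebra.
From mathcomp Require Import boolp classical_sets reals.
From mathcomp Require Import complex ring.

Set Implicit Arguments.
Unset Strict Implicit.
Unset Printing Implicit Defensive.

Import Order.TTheory GRing.Theory Num.Theory.

Local Open Scope classical_set_scope.
Local Open Scope ring_scope.

(** * Polynomials evaluated at a matrix *)

(** Used to write a fourth root of a matrix as a polynomial in it, which keeps the root real and
    symmetric. *)
Lemma poly_interpolation (F : fieldType) (f : F -> F) (s : seq F) :
  exists p : {poly F}, forall a, a \in s -> p.[a] = f a.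
Proof.
elim: s => [|a s [p pE]]; first by exists 0.
have [a_s|a_notin_s] := boolP (a \in s).
  by exists p => b; rewrite inE => /predU1P[->|]; exact: pE.
pose q := \prod_(b <- s) ('X - b%:P).
have qa_neq0 : q.[a] != 0 by rewrite -rootE root_prod_XsubC.
(* Newton's correction: it vanishes on [s] and repairs the value at [a]. *)
exists (p + ((f a - p.[a]) / q.[a])%:P * q) => b; rewrite hornerD hornerCM inE.
case/predU1P => [->|b_s]; first by rewrite divfK // addrC subrK.
have /rootP -> : root q b by rewrite root_prod_XsubC.
by rewrite mulr0 addr0 pE.
Qed.

Lemma trmx_horner (F : comNzRingType) (d : nat) (A : 'M[F]_d.+1) (p : {poly F}) :
  A^T = A -> (horner_mx A p)^T = horner_mx A p.
Proof.
move=> A_sym; elim/poly_ind: p => [|p c IHp]; first by rewrite rmorph0 trmx0.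
rewrite rmorphD rmorphM /= horner_mx_X horner_mx_C linearD /= tr_scalar_mx.
by rewrite -mulmxE trmx_mul A_sym IHp comm_mx_horner.
Qed.

(** * Quadratic forms, Gram matrices and eigenvalues *)

Section PositiveSemidefinite.
Variable R : realType.

Lemma qformE (d : nat) (A : 'M[R]_d) (v : 'cV[R]_d) :
  qform A v = \tr (A *m (v *m v^T)).
Proof. by rewrite mulmxA mxtrace_mulC mulmxA /mxtrace big_ord1. Qed.

(** The squared Frobenius norm of [X], through which matrices are later shown to vanish. *)
Lemma gram_tr (m d : nat) (X : 'M[R]_(m, d)) :
  \tr (X^T *m X) = \sum_j \sum_i X i j ^+ 2.
Proof.
apply: eq_bigr => j _; rewrite mxE; apply: eq_bigr => i _.
by rewrite mxE expr2.
Qed.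

Lemma gram_tr_ge0 (m d : nat) (X : 'M[R]_(m, d)) : 0 <= \tr (X^T *m X).
Proof. by rewrite gram_tr; do 2?apply: sumr_ge0 => ? _; exact: sqr_ge0. Qed.

Lemma gram_tr_eq0 (m d : nat) (X : 'M[R]_(m, d)) : \tr (X^T *m X) = 0 -> X = 0.
Proof.
rewrite gram_tr => /eqP; rewrite psumr_eq0 => [/allP X0|j _]; last first.
  by apply: sumr_ge0 => i _; exact: sqr_ge0.
apply/matrixP => i j; rewrite mxE; apply/eqP.
move: (X0 j (mem_index_enum j)).
rewrite psumr_eq0 => [/allP Xj0|k _]; last exact: sqr_ge0.
by move: (Xj0 i (mem_index_enum i)); rewrite sqrf_eq0.
Qed.

Lemma psdmx_congr (m d : nat) (A : 'M[R]_m) (X : 'M[R]_(m, d)) :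
  psdmx A -> psdmx (X^T *m A *m X).
Proof.
case=> A_sym A_ge0; split; first by rewrite !trmx_mul trmxK A_sym mulmxA.
by move=> v; have := A_ge0 (X *m v); rewrite /qform trmx_mul !mulmxA.
Qed.

Lemma psdmx1 (d : nat) : psdmx (1%:M : 'M[R]_d).
Proof.
split=> [|v]; first exact: tr_scalar_mx.
by rewrite qformE mul1mx mxtrace_mulC gram_tr_ge0.
Qed.

Lemma psdmx_gram (m d : nat) (X : 'M[R]_(m, d)) : psdmx (X^T *m X).
Proof. by have := psdmx_congr X (psdmx1 m); rewrite mulmx1. Qed.

Lemma psdmxZ (d : nat) (c : R) (A : 'M[R]_d) :
  0 <= c -> psdmx A -> psdmx (c *: A).
Proof.
move=> c_ge0 [A_sym A_ge0]; split=> [|v]; first by rewrite linearZ /= A_sym.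
by rewrite qformE -scalemxAl mxtraceZ -qformE mulr_ge0.
Qed.

Lemma psdmx_tr_ge0 (d : nat) (A : 'M[R]_d) : psdmx A -> 0 <= \tr A.
Proof.
case=> _ A_ge0; apply: sumr_ge0 => i _; have := A_ge0 (delta_mx i 0).
by rewrite /qform trmx_delta -rowE -colE !mxE.
Qed.

Lemma pdmx_psdmx (d : nat) (A : 'M[R]_d) : pdmx A -> psdmx A.
Proof.
case=> A_sym A_gt0; split=> // v; have [->|v0] := eqVneq v 0.
  by rewrite /qform mulmx0 mxE.
exact/ltW/A_gt0.
Qed.

Lemma pdmx_unit (d : nat) (A : 'M[R]_d) : pdmx A -> A \in unitmx.
Proof.
(* A nonzero row [r] of the left kernel would give [r A r^T = 0]. *)
case=> A_sym A_gt0; rewrite -row_free_unit -kermx_eq0; apply/eqP/row_matrixP => i.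
apply/eqP; rewrite row0; apply: contraT => r0.
have /A_gt0 : (row i (kermx A))^T != 0 by rewrite trmx_eq0.
by rewrite /qform trmxK -row_mul mulmx_ker row0 mul0mx mxE ltxx.
Qed.

(** A row eigenvector [v] gives [v A v^T = a |v|^2] with [|v|^2 > 0]. *)
Lemma psdmx_eigenvalue_ge0 (d : nat) (A : 'M[R]_d) (a : R) :
  psdmx A -> eigenvalue A a -> 0 <= a.
Proof.
case=> _ A_ge0 /eigenvalueP[v vA v0]; have := A_ge0 v^T.
rewrite /qform trmxK vA -scalemxAl mxE -[(_ *m _) 0 0]trace_mx11 => av.
have v_gt0 : 0 < \tr (v *m v^T).
  have := gram_tr_ge0 v^T; rewrite trmxK le_eqVlt => /predU1P[|//].
  move: (@gram_tr_eq0 _ _ v^T); rewrite trmxK => v_eq0 /esym/v_eq0/eqP.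
  by rewrite trmx_eq0 (negPf v0).
by rewrite -(pmulr_lge0 _ v_gt0).
Qed.

(** * Diagonalization and existence of square roots *)

(** The spectral theorem is applied to [A] seen as a complex Hermitian matrix. The eigenvalues come
    back to [R], while [P] stays complex. *)
Lemma psdmx_diagonalizable (d : nat) (A : 'M[R]_d) : psdmx A ->
  exists2 P : 'M[R[i]]_d, P \in unitmx & exists2 l : 'rV[R]_d, forall j, 0 <= l 0 j &
    map_mx (real_complex R) A
      = invmx P *m map_mx (real_complex R) (diag_mx l) *m P.
Proof.
move=> A_psd; set Ac := map_mx _ A; have A_sym := A_psd.1.
have Ac_real : Ac \is a mxOver Num.real.
  by apply/mxOverP => i j; rewrite mxE; apply/complex_realP; exists (A i j).
have Ac_herm : Ac \is hermsymmx.
  apply: realsym_hermsym => //; apply/is_hermitianmxP.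
  by rewrite expr0 scale1r map_mx_id // /Ac map_trmx A_sym.
have /orthomx_spectralP AcE := hermitian_normalmx Ac_herm.
have P_unit := spectral_unit Ac.
set P := spectralmx Ac in AcE P_unit.
pose l := map_mx (@complex.Re R) (spectral_diag Ac).
have lE : map_mx (real_complex R) l = spectral_diag Ac.
  apply/matrixP => i j; rewrite !mxE; apply: RRe_real.
  by move/mxOverP: (hermitian_spectral_diag_real Ac_herm).
exists P => //; exists l; last by rewrite map_diag_mx lE.
move=> j; apply: (psdmx_eigenvalue_ge0 A_psd).
(* Row [j] of [P] is a complex eigenvector for [l 0 j], and being an eigenvalue is insensitive to
   the field extension. *)
rewrite -(eigenvalue_map (real_complex R)); apply/eigenvalueP; exists (row j P).
  rewrite -/Ac AcE -row_mul !mulmxA mulmxV // mul1mx -lE row_mul row_diag_mx.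
  by rewrite -scalemxAl -rowE !mxE.
apply/eqP => rowP0; move: P_unit; rewrite -row_free_unit => /row_freeP[X XE].
have /rowP/(_ j) := congr1 (row j) XE.
by rewrite row_mul rowP0 mul0mx !mxE eqxx => /eqP; rewrite eq_sym oner_eq0.
Qed.

(* A fourth root [Q] makes the square root [Q *m Q = Q^T *m Q] visibly positive
   semidefinite. *)
Lemma psdmx_root4 (d : nat) (A : 'M[R]_d) : psdmx A ->
  exists2 Q : 'M[R]_d, Q^T = Q & Q *m Q *m (Q *m Q) = A.
Proof.
case: d A => [|d] A A_psd.
  by exists 0; rewrite ?flatmx0 // [RHS]flatmx0.
have [P P_unit [l l_ge0 AE]] := psdmx_diagonalizable A_psd.
(* Only the finitely many eigenvalues matter, so a real polynomial [q] stands in for the fourth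
   root, and [horner_mx A q] is real although [P] is complex. *)
have [q qE] := poly_interpolation (fun a => Num.sqrt (Num.sqrt a))
  [seq l 0 j | j : 'I_d.+1].
exists (horner_mx A q); first exact/trmx_horner/A_psd.1.
apply: (map_mx_inj (f := real_complex R)).
rewrite !mulmxE -!rmorphM /= map_horner_mx AE horner_mx_uconjC //.
rewrite -map_horner_mx horner_mx_diag; congr (_ *m map_mx _ (diag_mx _) *m _).
apply/rowP => j; rewrite mxE !hornerM qE; last exact: (map_f _ (mem_enum _ _)).
by rewrite -!expr2 !sqr_sqrtr ?sqrtr_ge0.
Qed.

Lemma sqrtmxP (d : nat) (A : 'M[R]_d) : psdmx A ->
  psdmx (sqrtmx A) /\ sqrtmx A *m sqrtmx A = A.
Proof.
move=> /psdmx_root4[Q Q_sym QE]; rewrite /sqrtmx; case: xgetP => [B -> //|noroot].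
case: (noroot (Q *m Q)); split => //.
by have := psdmx_gram Q; rewrite Q_sym.
Qed.

(** * Square roots of rank-one matrices *)

(** For [s > 0] the hypotheses make [A / s^2] a projection of trace one, so the root of [A] is
    [A / s], of trace [s]. *)
Lemma sqrtmx_tr (d : nat) (A : 'M[R]_d) (s : R) : psdmx A -> 0 <= s ->
  \tr A = s ^+ 2 -> A *m A = s ^+ 2 *: A -> \tr (sqrtmx A) = s.
Proof.
move=> A_psd s_ge0 trA AA; have [B_psd BE] := sqrtmxP A_psd.
have [B_sym _] := B_psd; set B := sqrtmx A in B_psd BE B_sym *.
move: s_ge0; rewrite le_eqVlt => /predU1P[s0|s_gt0].
  suff -> : B = 0 by rewrite mxtrace0.
  by apply: gram_tr_eq0; rewrite B_sym BE trA -s0 expr0n.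
(* With [B + s] injective, [(B + s) *m (A *m B - s *: A) = A *m A - s ^+ 2 *: A = 0]
   gives [A *m B = s *: A], and then [A - s *: B] squares to zero. *)
have BsX0 (X : 'M[R]_d) : B *m X + s *: X = 0 -> X = 0.
  (* The trace against [X^T] is a sum of two nonnegative terms, one of them [s] times the squared
     norm of [X]. *)
  move=> /(congr1 (mulmx X^T)) /(congr1 mxtrace).
  rewrite mulmx0 mulmxDr mulmxA -scalemxAr mxtraceD mxtraceZ mxtrace0 => /eqP.
  rewrite paddr_eq0; first last.
  - by rewrite mulr_ge0 ?gram_tr_ge0 // ltW.
  - exact/psdmx_tr_ge0/psdmx_congr.
  by case/andP=> _; rewrite mulf_eq0 gt_eqF //= => /eqP/gram_tr_eq0.
have AB : A *m B = B *m A by rewrite -BE mulmxA.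
have ABs : A *m B = s *: A.
  apply/subr0_eq/BsX0; rewrite mulmxBr mulmxA -AB -mulmxA BE AA -scalemxAr -AB.
  by rewrite scalerBr scalerA -expr2 addrA subrK subrr.
have A_eq : A = s *: B.
  apply/subr0_eq/gram_tr_eq0.
  have -> : (A - s *: B)^T = A - s *: B.
    by rewrite linearB linearZ /= B_sym A_psd.1.
  rewrite mulmxBr !mulmxBl -!scalemxAr -!scalemxAl.
  rewrite -AB ABs AA BE !scalerA -expr2.
  by rewrite !subrr mxtrace0.
move: trA; rewrite {1}A_eq mxtraceZ expr2 => /mulfI -> //.
by rewrite gt_eqF.
Qed.

(** Since [w w^T w w^T = |w|^2 w w^T], the previous lemma applies with [s^2 = c |w|^2]. *)
Lemma sqrtmx_rank1_tr (d : nat) (c : R) (w : 'cV[R]_d) : 0 <= c ->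
  \tr (sqrtmx (c *: (w *m w^T))) = Num.sqrt (c * \tr (w^T *m w)).
Proof.
move=> c_ge0; have cw_ge0 : 0 <= c * \tr (w^T *m w) by rewrite mulr_ge0 ?gram_tr_ge0.
apply: sqrtmx_tr; rewrite ?sqrtr_ge0 ?sqr_sqrtr //.
- by apply: psdmxZ => //; have := psdmx_gram w^T; rewrite trmxK.
- by rewrite mxtraceZ mxtrace_mulC.
rewrite -scalemxAl -scalemxAr.
have -> : w *m w^T *m (w *m w^T) = \tr (w^T *m w) *: (w *m w^T).
  rewrite mulmxA -(mulmxA w) [w^T *m w]mx11_scalar mul_mx_scalar -scalemxAl.
  by rewrite mxtrace_scalar mulr1n.
by rewrite !scalerA mulrAC.
Qed.

(** With [H = sqrtmx A], the inner matrix is [c (H z) (H z)^T], again of rank at most one, and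
    [|H z|^2 = z^T A z]. *)
Lemma bw_dist2_rank1 (d : nat) (A : 'M[R]_d) (c : R) (z : 'cV[R]_d) :
  psdmx A -> 0 <= c ->
  bw_dist2 A (c *: (z *m z^T))
    = \tr A + c * \tr (z *m z^T) - 2 * (Num.sqrt (qform A z) * Num.sqrt c).
Proof.
move=> A_psd c_ge0; have [[H_sym _] HH] := sqrtmxP A_psd.
rewrite /bw_dist2 raddfB raddfD /= !mxtraceZ; congr (_ - 2 * _).
rewrite -scalemxAr -scalemxAl !mulmxA -{2}H_sym -(mulmxA (_ *m z)) -trmx_mul.
rewrite sqrtmx_rank1_tr // sqrtrM // [RHS]mulrC; congr (_ * _).
congr Num.sqrt.
by rewrite /qform trace_mx11 trmx_mul H_sym !mulmxA -(mulmxA z^T _ (sqrtmx A)) HH.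
Qed.

End PositiveSemidefinite.

Theorem proposition2 (R : realType) (d n : nat) (S : 'M[R]_d)
    (x : 'I_n -> 'cV[R]_d) (y : 'cV[R]_n)
    (S_psd : psdmx S)
    (yE : forall i, y i 0 = qform S (x i))
    (C_pd : pdmx (emp_cov x)) :
  let C := emp_cov x in
  let P1 := argmin (@psdmx R d) (fun Sigma =>
    (2 * n%:R)^-1 *
    sqnorm2 (map_mx Num.sqrt
               (quad_meas x (invsqrtmx C *m Sigma *m invsqrtmx C))
             - map_mx Num.sqrt y)) in
  let P2 := argmin (@psdmx R d) (fun Sigma =>
    (2 * n%:R)^-1 *
    \sum_(i < n) bw_dist2 Sigma
      (y i 0 *: (invsqrtmx C *m x i *m (x i)^T *m invsqrtmx C))) in
  P1 = P2 /\ P1 (sqrtmx C *m S *m sqrtmx C) /\ P2 (sqrtmx C *m S *m sqrtmx C).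
Proof.
move=> C; set f1 := fun Sigma => _; set f2 := fun Sigma => _; move=> P1 P2.
have [[H_sym _] HH] := sqrtmxP (pdmx_psdmx C_pd).
rewrite -/C in H_sym HH; pose H := sqrtmx C; pose K := invsqrtmx C.
have H_unit : H \in unitmx.
  by have := pdmx_unit C_pd; rewrite -/C -HH unitmx_mul => /andP[].
have K_sym : K^T = K by rewrite trmx_inv H_sym.
pose z i := K *m x i.
have y_ge0 i : 0 <= y i 0 by rewrite yE; exact: S_psd.2.
have qformK A i : qform (K *m A *m K) (x i) = qform A (z i).
  by rewrite /qform /z trmx_mul K_sym !mulmxA.
have sum_zz : \sum_(i < n) z i *m (z i)^T = n%:R%:M.
  have -> : \sum_(i < n) z i *m (z i)^T = K *m (n%:R *: C) *m K.
    have -> : n%:R *: C = \sum_(i < n) x i *m (x i)^T.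
      (* The factor [n] cannot be cancelled when [n = 0], but then both sides vanish. *)
      rewrite /C /emp_cov; have [n0|n0] := eqVneq (n%:R : R) 0; last first.
        by rewrite scalerA divff // scale1r.
      rewrite n0 scale0r big1 // => i _; have := leq_ltn_trans (leq0n i) (ltn_ord i).
      by rewrite lt0n -(pnatr_eq0 R) n0 eqxx.
    rewrite mulmx_sumr mulmx_suml; apply: eq_bigr => i _.
    by rewrite trmx_mul K_sym !mulmxA.
  by rewrite -scalemxAr -scalemxAl -HH mulmxA mulVmx // mul1mx mulmxV // scalemx1.
(* The value [n tr A] is kept as a sum over [i], to be merged termwise with the other sums in
   [f12]. *)
have sum_qform A : \sum_(i < n) qform A (z i) = \sum_(i < n) \tr A.
  under eq_bigr do rewrite qformE.
  rewrite -raddf_sum /= -mulmx_sumr sum_zz mul_mx_scalar mxtraceZ.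
  by rewrite sumr_const card_ord mulr_natl.
(* What remains of [f1 - f2] once the traces and the cross terms cancel: [y_i] against
   [y_i |z_i|^2]. *)
pose c := (2 * n%:R)^-1 * \sum_(i < n) y i 0 * (1 - \tr (z i *m (z i)^T)).
have f12 A : psdmx A -> f1 A = f2 A + c.
  move=> A_psd; rewrite /f1 /f2 /c -mulrDr; congr (_ * _).
  transitivity (\sum_(i < n) (qform A (z i) + y i 0
                   - 2 * (Num.sqrt (qform A (z i)) * Num.sqrt (y i 0)))).
    apply: eq_bigr => i _; rewrite !mxE qformK sqrrB !sqr_sqrtr ?A_psd.2 //.
    by rewrite mulr_natl addrAC.
  rewrite sumrB big_split /= sum_qform -!big_split -sumrB /=; apply: eq_bigr => i _ /=.
  have -> : K *m x i *m (x i)^T *m K = z i *m (z i)^T.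
    by rewrite trmx_mul K_sym !mulmxA.
  rewrite bw_dist2_rank1 //; ring.
have P12 : P1 = P2.
  apply/seteqP; split=> A [A_psd minA]; split=> // B B_psd;
    by have := minA B B_psd; rewrite !f12 // lerD2r.
suff P1S : P1 (H *m S *m H) by rewrite -P12.
split=> [|B B_psd]; first by have := psdmx_congr H S_psd; rewrite H_sym.
(* As [K] inverts [H], the matrix being measured is [S] itself, whose measurements are [y]. *)
have -> : f1 (H *m S *m H) = 0.
  rewrite /f1 !mulmxA mulVmx // mul1mx -mulmxA mulmxV // mulmx1.
  rewrite /sqnorm2 big1 ?mulr0 // => i _.
  by rewrite !mxE yE subrr expr0n.
rewrite mulr_ge0 ?invr_ge0 ?mulr_ge0 ?ler0n //.
by apply: sumr_ge0 => i _; exact: sqr_ge0.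
Qed.
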